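(* For every $\gamma>0$ there exists $n_0\in\mathbb{Z}$ such that for every graph $X$ with $f_0(X)\geq n_0$ the following hold: (I1) if $\delta(X)\geq(\tfrac12+\gamma)f_0(X)$ and $f_0(X)$ is odd, then $X$ is Hamilton-generated; (I2) if $\delta(X)\geq(\tfrac12+\gamma)f_0(X)$ and $f_0(X)$ is even, then the set of all Hamilton circuits of $X$ spans a subspace of codimension one in $\mathrm{Z}_1(X;\mathbb{Z}/2)$, and the set of all circuits of $X$ whose length is $f_0(X)-1$ or $f_0(X)$ spans all of $\mathrm{Z}_1(X;\mathbb{Z}/2)$; (I3) if $\delta(X)\geq(\tfrac14+\gamma)f_0(X)$ and $X$ is square bipartite, then $X$ is Hamilton-generated. (I4) Moreover, if in (I1) and (I2) the condition $\delta(X)\geq(\tfrac12+\gamma)f_0(X)$ is replaced by $\delta(X)\geq\tfrac23 f_0(X)$, then the conclusions of (I1) and (I2) hold for every graph $X$ with $f_0(X)\geq 2\cdot 10^8$. Furthermore, (I1) becomes false if the hypothesis $\delta(X)\geq(\tfrac12+\gamma)f_0(X)$ is replaced by ''$\delta(X)\geq\lfloor f_0(X)/2\rfloor$ and $X$ is Hamilton-connected'' (there is a Hamilton-connected graph $X$ with $f_0(X)$ odd and $\delta(X)\geq\lfloor f_0(X)/2\rfloor$ which is not Hamilton-generated), and (I3) becomes false if the hypothesis $\delta(X)\geq(\tfrac14+\gamma)f_0(X)$ is replaced by ''$\delta(X)\geq\tfrac14 f_0(X)$ and $X$ is hamiltonian'' (there is a hamiltonian square bipartite graph $X$ with $\delta(X)\geq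 \tfrac14 f_0(X)$ which is not Hamilton-generated).
   Context: All graphs are finite, simple and undirected. For a graph $X$, $f_0(X)$ is its number of vertices and $\delta(X)$ its minimum degree. $\mathrm{Z}_1(X;\mathbb{Z}/2)$ is the cycle space of $X$, i.e. the kernel of the simplicial boundary map $\mathrm{C}_1(X;\mathbb{Z}/2)\to\mathrm{C}_0(X;\mathbb{Z}/2)$, equivalently the $\mathbb{Z}/2$-vector space of edge sets in which every vertex has even degree (with symmetric difference as addition); a circuit (connected 2-regular subgraph) is identified with the element of $\mathrm{C}_1(X;\mathbb{Z}/2)$ whose support is its edge set. A Hamilton circuit is a circuit through all vertices. $X$ is called Hamilton-generated if the set of all Hamilton circuits of $X$ spans $\mathrm{Z}_1(X;\mathbb{Z}/2)$ over $\mathbb{Z}/2$. A graph is Hamilton-connected if any two distinct vertices are joined by a Hamilton path. A bipartite graph is square if its two bipartition classes have equal size. *)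

(* Defs.v *)
From HB Require Import structures.
From mathcomp Require Import all_boot all_order all_algebra.
From mathcomp Require Import reals.

Set Implicit Arguments.
Unset Strict Implicit.
Unset Printing Implicit Defensive.

Import GRing.Theory.
Local Open Scope ring_scope.

Record sgraph := SGraph {
  vertex :> finType;
  adj : rel vertex;
  adj_sym : symmetric adj;
  adj_irrefl : irreflexive adj }.

Section Graph.
Variable X : sgraph.
Implicit Types (x y v : X) (W : {set X}) (F : {set {set X}}).

Definition f0 : nat := #|X|.

Definition deg v : nat := #|[set w | adj v w]|.

(* Every degree is less than [f0], so for nonempty [X] the default value of the
   big minimum is never attained; on the empty graph the value is 0. *)
Definition mindeg : nat := \big[minn/f0]_(v : X) deg v.

Definition edges : {set {set X}} :=
  [set [set p.1; p.2] | p : X * X & adj p.1 p.2].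

Definition edge : finType := {f : {set X} | f \in edges}.

Local Notation C1 := {ffun edge -> ('F_2)^o}.
Local Notation C0 := {ffun X -> ('F_2)^o}.

Definition boundary (c : C1) : C0 :=
  [ffun v => \sum_(f : edge | v \in val f) c f].

Fact boundary_is_linear : linear boundary.
Proof.
move=> a c d; apply/ffunP=> v; rewrite !ffunE scaler_sumr -big_split /=.
by apply: eq_bigr => f _; rewrite !ffunE.
Qed.

HB.instance Definition _ :=
  GRing.isLinear.Build 'F_2 C1 C0 _ boundary boundary_is_linear.

Definition Z1 : {vspace C1} := lker (linfun boundary).

(* [(W, F)] is a connected 2-regular subgraph of [X]; as it has no isolated
   vertex, it is determined by its edge set [F]. *)
Definition is_circuit W F : bool :=
  [&& W != set0,
      F \subset edges,
      [forall f in F, f \subset W],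
      [forall v in W, #|[set f in F | v \in f]| == 2]
    & [forall x in W, forall y in W,
         connect (fun u w => [set u; w] \in F) x y]].

Definition circuits : {set {set {set X}}} :=
  [set F | [exists W, is_circuit W F]].

Definition hamilton_circuits : {set {set {set X}}} :=
  [set F | is_circuit [set: X] F].

Definition edge_chain F : C1 := [ffun f => (val f \in F)%:R].

Definition circuit_span (S : {set {set {set X}}}) : {vspace C1} :=
  <<[seq edge_chain F | F in S]>>%VS.

Definition hamilton_generated : Prop := circuit_span hamilton_circuits = Z1.

Definition hamilton_codim1 : Prop :=
  (circuit_span hamilton_circuits <= Z1)%VS /\
  \dim Z1 = (\dim (circuit_span hamilton_circuits)).+1.

Definition long_circuits : {set {set {set X}}} :=
  [set F in circuits | (#|F| == f0.-1) || (#|F| == f0)].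

Definition hamiltonian : Prop := exists F, F \in hamilton_circuits.

Definition hamilton_path x (p : seq X) y : Prop :=
  [/\ path (@adj X) x p, last x p = y, uniq (x :: p)
    & forall z : X, z \in x :: p].

Definition hamilton_connected : Prop :=
  forall x y, x != y -> exists p, hamilton_path x p y.

Definition square_bipartite : Prop :=
  exists A : {set X}, #|A| = #|~: A| /\
    forall x y, adj x y -> (x \in A) != (y \in A).

End Graph.

(* Main.v *)
Require Import Defs.
From HB Require Import structures.
From mathcomp Require Import all_boot all_order all_algebra.
From mathcomp Require Import reals zify ring lra.

Set Implicit Arguments.
Unset Strict Implicit.
Unset Printing Implicit Defensive.

Import Order.TTheory GRing.Theory Num.Theory.
Local Open Scope ring_scope.

(** By duality it suffices to show that a weight [phi] on the edges, with values
    in Z/2, which vanishes on every Hamilton circuit is of the form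
    [phi xy = q x + q y + c].

    Let [x1 .. x6] be a hexagon.  Join [x1] to [x4] and [x2] to [x5] by paths of
    length 3 and [x3] to [x6] by a Hamilton path of the remaining graph; the
    degree condition allows this.  These three paths close up to a Hamilton
    circuit with either of the two perfect matchings of the hexagon, so the
    hexagon is a sum of two Hamilton circuits and [phi] vanishes on it.  Every
    4-circuit is a sum of two hexagons.  Since any two vertices (on the same
    side, in the bipartite case) have many common neighbours, the vanishing of
    [phi] on 4-circuits and hexagons makes [q v := phi r w + phi w v], with [w] a
    common neighbour of [v] and a root [r], into the required potential.

    In the bipartite case [c] can be absorbed into [q].  Otherwise it is killed by
    a circuit of odd length among the given generators, and if there is none it
    accounts for the missing dimension.

    For the first counterexample, a Hamilton circuit runs along a path through a
    triangle of vertices of degree 3, hence it uses the edge leaving the triangle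
    at one vertex iff it uses the opposite side.  For the second one, no
    Hamilton circuit uses the long chord of a hexagon. *)

(** * Hamilton paths between prescribed ends *)

Section ChainSum.
Variables (T : eqType) (V : nmodType).
Implicit Types (f : T -> T -> V) (l a b : seq T).

(** With values in [nat] this counts the steps of a list that are missing from a relation; with
    values in Z/2 it adds up edge weights along a walk. *)
Fixpoint chain_sum f l : V :=
  if l is x :: l' then (if l' is y :: _ then f x y else 0) + chain_sum f l'
  else 0.

Lemma chain_sum_cat f a x y b :
  chain_sum f (rcons a x ++ y :: b) =
  chain_sum f (rcons a x) + f x y + chain_sum f (y :: b).
Proof.
elim: a => [|z a IHa] /=; first by rewrite !add0r.
by rewrite IHa !addrA; case: a {IHa}.
Qed.

Lemma chain_sum_rev f l : (forall x y, f x y = f y x) ->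
  chain_sum f (rev l) = chain_sum f l.
Proof.
move=> fC; elim: l => //= x [|y l] IHl //=.
rewrite rev_cons -cats1 rev_cons chain_sum_cat /= !addr0 -rev_cons IHl /=.
by rewrite addrC fC.
Qed.

(* Reversing the block [y :: m = rcons m' z] trades the steps [x y], [z w]
   for [x z], [y w]. *)
Lemma chain_sum_reverse_block f a x y m z m' w b :
  (forall u v, f u v = f v u) -> y :: m = rcons m' z ->
  chain_sum f (rcons a x ++ rev (y :: m) ++ w :: b) + (f x y + f z w) =
  chain_sum f (rcons a x ++ (y :: m) ++ w :: b) + (f x z + f y w).
Proof.
move=> fC eq_m.
have E1 : chain_sum f (rcons a x ++ (y :: m) ++ w :: b) =
  chain_sum f (rcons a x) + f x y + (chain_sum f (y :: m) + f z w + chain_sum f (w :: b)).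
  by rewrite cat_cons chain_sum_cat -cat_cons eq_m chain_sum_cat.
have E2 : chain_sum f (rcons a x ++ rev (y :: m) ++ w :: b) =
  chain_sum f (rcons a x) + f x z + (chain_sum f (y :: m) + f y w + chain_sum f (w :: b)).
  rewrite {1}eq_m rev_rcons cat_cons chain_sum_cat -cat_cons -rev_rcons -eq_m.
  by rewrite rev_cons chain_sum_cat -rev_cons chain_sum_rev.
rewrite E1 E2.
move: (chain_sum f (rcons a x)) (chain_sum f (y :: m)) (chain_sum f (w :: b)).
by move=> A B C; rewrite !addrA [LHS](ACl (1*6*3*7*5*2*4)).
Qed.

End ChainSum.

Section ChainBad.
Variables (T : eqType).
Implicit Types (e : rel T) (l a b : seq T).

Definition bad e (x y : T) : nat := ~~ e x y.

Lemma chain_bad_eq0 e u p : (chain_sum (bad e) (u :: p) == 0) = path e u p.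
Proof.
elim: p u => [|v p IHp] u //=; rewrite -[in RHS]IHp /= addn_eq0 eqb0 negbK.
by [].
Qed.

Lemma not_path_split e u p : ~~ path e u p ->
  exists a x y b, u :: p = a ++ x :: y :: b /\ ~~ e x y.
Proof.
elim: p u => [|v p IHp] u //=; rewrite negb_and => /orP[ne|/IHp].
  by exists [::], u, v, p.
by case=> a [x] [y] [b] [-> ne]; exists (u :: a), x, y, b.
Qed.

Lemma path_step e u p a x y b : path e u p -> u :: p = a ++ x :: y :: b -> e x y.
Proof.
elim: a u p => [|z a IHa] u p ep [Eu Ep]; first by move: ep; rewrite Eu Ep /= => /andP[].
case: p => [|v p] in ep Ep; first by case: a Ep {IHa}.
by case/andP: ep => _ /IHa; apply.
Qed.

Lemma mem_split x l : x \in l -> exists a b, l = a ++ x :: b.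
Proof. by case/splitPr=> a b; exists a, b. Qed.

Lemma next_cat a x y b :
  uniq (a ++ x :: y :: b) -> next (a ++ x :: y :: b) x = y.
Proof.
move=> U; rewrite -(next_rot (size a) U) rot_size_cat.
by rewrite /= eqxx.
Qed.

End ChainBad.

Section HamiltonPath.
(* [comp] is the full relation for general graphs, and [sides A] for bipartite
   ones. *)
Variables (T : finType) (e comp : rel T).
Hypothesis e_sym : symmetric e.
Hypothesis e_irr : irreflexive e.
Hypothesis comp_sym : symmetric comp.
Hypothesis sub_comp : subrel e comp.
(** This is the parity rule of a bipartition: the ends of the three-step walk [y x z w] lie on
    opposite sides. *)
Hypothesis comp_odd : forall x y z w, comp x y -> comp x z -> comp z w -> comp y w.
Variable U : {set T}.
(** An Ore-type condition. Of the surplus 2, one unit pays for the last vertex of a path, which has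
    no successor, and the other makes the pigeonhole count in [cross_pair] strict. *)
Hypothesis deg_large : {in U &, forall x y, comp x y ->
  #|[set w in U | comp y w]| + 2 <=
  #|[set w in U | e x w]| + #|[set w in U | e y w]|}%N.

(** Pigeonhole as in Ore's theorem: the successors of the [e]-neighbours of [x] and the
    [e]-neighbours of [y] all lie in the set [K] of vertices facing [y], and by [deg_large] they are
    too many to be disjoint. *)
Lemma cross_pair u p a x y b :
  uniq (u :: p) -> u :: p =i U -> path comp u p ->
  u :: p = a ++ x :: y :: b ->
  exists z w c d, [/\ u :: p = c ++ z :: w :: d, e x z & e y w].
Proof.
move=> Up memU cp eq_l; set l := u :: p in Up memU eq_l *.
have xl : x \in U by rewrite -memU eq_l mem_cat inE eqxx orbT.
have yl : y \in U by rewrite -memU eq_l mem_cat !inE eqxx !orbT.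
have step z : z \in U -> z != last u p ->
    exists c d, l = c ++ z :: next l z :: d.
  rewrite -memU => /mem_split[c [[|w d] eq_cd]].
    by rewrite -[last u p]/(last u l) eq_cd last_cat /= eqxx.
  by move=> _; exists c, d; rewrite {2}eq_cd next_cat // -eq_cd.
have comp_step c z w d (E : l = c ++ z :: w :: d) := path_step cp E.
have cxy : comp x y by apply: comp_step eq_l.
set N := [set w in U | e x w] :\ last u p.
set M := next l @: N.
set N' := [set w in U | e y w].
set K := [set w in U | comp y w].
have sMK : M \subset K.
  apply/subsetP=> w /imsetP[z]; rewrite !inE => /andP[zv /andP[zU exz]] ->.
  rewrite -memU mem_next memU zU /=.
  have [c [d /comp_step czw]] := step z zU zv.
  exact: comp_odd cxy (sub_comp exz) czw.
have sNK : N' \subset K.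
  by apply/subsetP=> w; rewrite !inE => /andP[-> /sub_comp].
have cM : #|M| = #|N|.
  by apply: card_in_imset => z w _ _; apply: (can_inj (prev_next Up)).
have dK := deg_large xl yl cxy.
have cN : (#|[set w in U | e x w]| <= #|N| + 1)%N.
  by rewrite (cardsD1 (last u p) [set w in U | e x w]) addnC leq_add2l leq_b1.
have : M :&: N' != set0.
  rewrite -card_gt0; have := cardsUI M N'.
  have : (#|M :|: N'| <= #|K|)%N by rewrite subset_leq_card // subUset sMK.
  rewrite -/N' -/K in dK; lia.
case/set0Pn => w /setIP[/imsetP[z]]; rewrite !inE => /andP[zv /andP[zU exz]] ->.
case/andP=> _ eyw; have [c [d eq_cd]] := step z zU zv.
by exists z, (next l z), c, d.
Qed.

(** Reversing the block between the non-edge [x y] and the crossing step [z w] trades these two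
    steps for the edges [x z] and [y w]. The block is interior, so both ends of the path stay
    fixed. *)
Lemma reverse_block_improves u v p :
  uniq (u :: p) -> u :: p =i U -> path comp u p -> last u p = v ->
  ~~ path e u p ->
  exists p', [/\ uniq (u :: p'), u :: p' =i U, path comp u p', last u p' = v
    & (chain_sum (bad e) (u :: p') < chain_sum (bad e) (u :: p))%N].
Proof.
move=> Up memU cp lp /not_path_split[a [x] [y] [b] [eq_l nxy]].
have [z [w] [c] [d] [eq_l' exz eyw]] := cross_pair Up memU cp eq_l.
have bad_sym (e' : rel T) : symmetric e' -> forall s t, bad e' s t = bad e' t s.
  by move=> e'C s t; rewrite /bad e'C.
have bad0 (e' : rel T) s t : e' s t -> bad e' s t = 0 by rewrite /bad => ->.
(* This form covers both positions of the step [z w], before or after [x y]; the non-edge is then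
   the second or the first of the two steps removed. *)
suff: exists a' m x' y' z' m' w' b',
  [/\ u :: p = rcons a' x' ++ (y' :: m) ++ w' :: b', y' :: m = rcons m' z',
      e x' z', e y' w' & ~~ e x' y' || ~~ e z' w'].
  case=> a' [m] [x'] [y'] [z'] [m'] [w'] [b'] [E Em exz' eyw' nb].
  have [p' Ep'] : exists p', u :: p' = rcons a' x' ++ rev (y' :: m) ++ w' :: b'.
    case: (a') E => [|a0 a'']  [-> _]; eexists; reflexivity.
  have perm : perm_eq (u :: p') (u :: p).
    by rewrite Ep' E perm_cat2l perm_cat2r perm_rev.
  have Ls f : (forall s t, f s t = f t s) ->
    (chain_sum f (u :: p') + (f x' y' + f z' w') =
     chain_sum f (u :: p) + (f x' z' + f y' w') :> nat)%N.
    by move=> fC; rewrite Ep' E; exact: chain_sum_reverse_block fC Em.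
  exists p'; split.
  - by rewrite (perm_uniq perm).
  - by move=> t; rewrite (perm_mem perm) memU.
  (* The same exchange identity for [comp]: the right-hand side is 0, so the new path has no step
     outside [comp] either. *)
  - rewrite -chain_bad_eq0; have := Ls _ (bad_sym comp comp_sym).
    move: cp; rewrite -chain_bad_eq0 => /eqP ->.
    rewrite (bad0 comp x' z' (sub_comp exz')) (bad0 comp y' w' (sub_comp eyw')).
    move: (chain_sum (bad comp) (u :: p')) (bad comp x' y') (bad comp z' w').
    by move=> k1 k2 k3; move/eqP; rewrite addn_eq0 => /andP[].
  - have -> : last u p' = last u (u :: p') by [].
    rewrite Ep' !last_cat /= -lp.
    by have -> : last u p = last u (u :: p) by []; rewrite E !last_cat.
  - have := Ls _ (bad_sym e e_sym).
    rewrite (bad0 e x' z' exz') (bad0 e y' w' eyw').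
    have : (0 < bad e x' y' + bad e z' w')%N by rewrite /bad; case/orP: nb => ->; lia.
    lia.
have Ul : uniq (a ++ x :: y :: b) by rewrite -eq_l.
have Ul' : uniq (c ++ z :: w :: d) by rewrite -eq_l'.
have zl : z \in a ++ x :: y :: b by rewrite -eq_l eq_l' mem_cat inE eqxx orbT.
have nxt : next (u :: p) z = w by rewrite eq_l' next_cat.
move: zl; rewrite mem_cat inE => /or3P[za|/eqP zx|zb].
- have [a1 [a2 Ea]] := mem_split za.
  have [w' [t ht]] : exists w' t, rcons a2 x = w' :: t.
    by case: (a2) => [|w' a2']; [exists x, [::] | exists w', (rcons a2' x)].
  have E1 : u :: p = a1 ++ z :: w' :: t ++ y :: b.
    by rewrite -cat_cons -ht cat_rcons eq_l Ea -catA.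
  have Ew : w' = w by rewrite -nxt E1 next_cat // -E1.
  rewrite {}Ew in ht E1.
  exists a1, t, z, w, x, a2, y, b; split=> //.
  + by rewrite E1 cat_rcons.
  + by rewrite e_sym.
  + by rewrite e_sym.
  + by rewrite nxy orbT.
- by rewrite zx e_irr in exz.
- have [b1 [[|w' b2] Eb]] := mem_split zb.
    have: last u (c ++ z :: w :: d) = z.
      by rewrite -eq_l' eq_l last_cat /= -[last y b]/(last x (y :: b)) Eb last_cat.
    rewrite last_cat /= => zd; move: Ul'; rewrite cat_uniq => /and3P[_ _] /=.
    by rewrite -{1}zd mem_last.
  have ew : w' = w.
    rewrite -nxt eq_l Eb -cat_cons catA next_cat //.
    by rewrite -catA /= -Eb.
  rewrite ew in Eb.
  have [m Em] : exists m, rcons b1 z = y :: m.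
    by case: (b1) Eb => [|y' b1'] [<- _]; [exists [::]|exists (rcons b1' z)].
  exists a, m, x, y, z, b1, w, b2; split=> //.
  + by rewrite eq_l -Em !cat_rcons Eb.
  + by rewrite nxy.
Qed.

(** Induction on the number of non-edges in a [comp]-arrangement with the prescribed ends. *)
Lemma hamilton_path_between u v p :
  uniq (u :: p) -> u :: p =i U -> path comp u p -> last u p = v ->
  exists p', [/\ path e u p', last u p' = v, uniq (u :: p') & u :: p' =i U].
Proof.
move En: (chain_sum (bad e) (u :: p)) => n.
elim/ltn_ind: n p En => n IHn p En Up memU cp lp.
have [ep|nep] := boolP (path e u p); first by exists p.
have [p' [Up' mU' cp' lp']] := reverse_block_improves Up memU cp lp nep.
by rewrite En => /IHn /(_ p' erefl Up' mU' cp' lp').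
Qed.

End HamiltonPath.

(** * Weights vanishing on Hamilton circuits *)

Lemma chain_sum_cat_cons (T : eqType) (V : nmodType) (f : T -> T -> V) x a y b :
  chain_sum f ((x :: a) ++ y :: b) =
  chain_sum f (x :: a) + f (last x a) y + chain_sum f (y :: b).
Proof. by rewrite (lastI x a) chain_sum_cat. Qed.

(* Abstracting the booleans keeps [lia] from splitting on each of them. *)
Ltac perm_by_count := apply/permP=> ?; rewrite /= ?count_cat /=;
  repeat match goal with |- context [nat_of_bool ?b] =>
    move: (nat_of_bool b) end; clear; lia.

Section DensePotential.
Variables (T : finType) (e comp : rel T) (m : nat).
Hypothesis e_sym : symmetric e.
Hypothesis e_irr : irreflexive e.
Hypothesis comp_sym : symmetric comp.
Hypothesis sub_comp : subrel e comp.
Hypothesis comp_odd : forall x y z w, comp x y -> comp x z -> comp z w -> comp y w.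
Hypothesis side_le : forall x, (#|[set w | comp x w]| <= m)%N.
(** The surplus 20 gives two vertices on the same side at least 20 common neighbours. It also
    outweighs the loss of 8 from each of two degrees when 8 vertices are deleted, leaving more than
    the 2 required by [deg_large]. *)
Hypothesis deg_ge : forall x, (m + 20 <= 2 * #|[set w | e x w]|)%N.
(** The deleted path has an even number of vertices; in the bipartite case it therefore takes
    equally many from each side, and what remains can still be traversed alternately. *)
Hypothesis arrangement : forall t0 t u v,
  uniq (t0 :: t) -> path comp t0 t -> odd (size t) ->
  u != v -> u \notin t0 :: t -> v \notin t0 :: t -> comp u v ->
  exists p, [/\ uniq (u :: p), u :: p =i ~: [set z in t0 :: t], path comp u p
    & last u p = v].

(** Inclusion-exclusion: both neighbourhoods lie in the side facing [x], which has at most [m]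
    vertices. *)
Lemma common_neighbour x y z (s : seq T) : comp x z -> comp z y ->
  (size s < 20)%N -> exists w, [/\ e x w, e y w & w \notin s].
Proof.
move=> cxz czy szs; set N := [set w | e x w] :&: [set w | e y w].
have sub : [set w | e x w] :|: [set w | e y w] \subset [set w | comp x w].
  apply/subsetP=> w; rewrite !inE => /orP[/sub_comp//|/sub_comp].
  by apply: comp_odd czy; rewrite comp_sym.
have := cardsUI [set w | e x w] [set w | e y w].
have := subset_leq_card sub; have := side_le x.
have := deg_ge x; have := deg_ge y; rewrite -/N => dy dx le1 le2 eqN.
have : N :\: [set w in s] != set0.
  have sz : (#|[set w in s]| <= size s)%N by rewrite cardsE card_size.
  rewrite -card_gt0 cardsD; have := subset_leq_card (subsetIr N [set w in s]).
  by lia.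
by case/set0Pn=> w; rewrite !inE => /and3P[ws exw eyw]; exists w.
Qed.

Lemma neighbour x (s : seq T) : (size s < 20)%N -> exists2 w, e x w & w \notin s.
Proof.
have [z exz] : exists z, e x z.
  apply/existsP; apply: contraTT (deg_ge x) => /existsPn nx.
  rewrite (_ : [set w | e x w] = set0) ?cards0 ?addnS //.
  by apply/setP=> w; rewrite !inE; apply/negbTE.
have czx : comp z x by rewrite comp_sym sub_comp.
by case/(common_neighbour (sub_comp exz) czx) => w [exw _ ws]; exists w.
Qed.

Lemma hamilton_path_avoiding t0 t u v :
  uniq (t0 :: t) -> path comp t0 t -> size t = 7%N ->
  u != v -> u \notin t0 :: t -> v \notin t0 :: t -> comp u v ->
  exists p, [/\ path e u p, last u p = v, uniq (u :: p)
    & u :: p =i ~: [set z in t0 :: t]].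
Proof.
move=> Ut ct st uv ut vt cuv.
have ot : odd (size t) by rewrite st.
have [p [Up memU cp lp]] := arrangement Ut ct ot uv ut vt cuv.
apply: hamilton_path_between Up memU cp lp => // x y _ _ cxy.
set S := [set z in t0 :: t].
have cS : (#|S| <= 8)%N by rewrite cardsE (leq_trans (card_size _)) //= st.
have dS z : (#|[set w | e z w]| <= #|[set w in ~: S | e z w]| + 8)%N.
  rewrite -(cardsID S) addnC leq_add //.
    by apply/subset_leq_card/subsetP=> w; rewrite !inE => /andP[-> ->].
  by apply: leq_trans cS; rewrite subset_leq_card // subsetIr.
have : (#|[set w in ~: S | comp y w]| <= m)%N.
  apply: leq_trans (side_le y); apply/subset_leq_card/subsetP=> w.
  by rewrite !inE => /andP[_ ->].
by have := dS x; have := dS y; have := deg_ge x; have := deg_ge y; lia.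
Qed.

Variables (V : comNzRingType) (phi : T -> T -> V).
Hypothesis V2 : forall a : V, a + a = 0.
Hypothesis phi_sym : forall x y, phi x y = phi y x.
Hypothesis phi_hamilton : forall x p, uniq (x :: p) -> path e x (rcons p x) ->
  (forall z, z \in x :: p) -> chain_sum phi (x :: rcons p x) = 0.

(* The paths [x1 p q x4], [x5 s r x2] and a Hamilton path from [x3] to [x6] of
   the remaining graph close up to a Hamilton circuit both with the edges
   [x4 x5], [x2 x3], [x6 x1] and with the edges [x4 x3], [x6 x5], [x2 x1]. *)
Lemma phi_hexagon x1 x2 x3 x4 x5 x6 : uniq [:: x1; x2; x3; x4; x5; x6] ->
  e x1 x2 -> e x2 x3 -> e x3 x4 -> e x4 x5 -> e x5 x6 -> e x6 x1 ->
  phi x1 x2 + phi x2 x3 + phi x3 x4 + phi x4 x5 + phi x5 x6 + phi x6 x1 = 0.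
Proof.
move=> Ux e12 e23 e34 e45 e56 e61.
have eC x y : e x y -> e y x by rewrite e_sym.
have c x y : e x y -> comp x y := @sub_comp x y.
have cC x y : e x y -> comp y x by move=> exy; rewrite comp_sym c.
set X := [:: x1; x2; x3; x4; x5; x6] in Ux.
have [p e1p pX] := neighbour x1 (s := X) isT.
(* Opposite vertices of a hexagon are three steps apart, so each of the three connecting paths joins
   opposite sides. *)
have c14 : comp x1 x4 by apply: comp_odd (cC _ _ e12) (c _ _ e23) (c _ _ e34).
have [q [epq e4q qX]] := common_neighbour (s := p :: X) (cC _ _ e1p) c14 isT.
have [r e2r rX] := neighbour x2 (s := q :: p :: X) isT.
have c25 : comp x2 x5 by apply: comp_odd (cC _ _ e23) (c _ _ e34) (c _ _ e45).
have [s [ers e5s sX]] := common_neighbour (s := r :: q :: p :: X) (cC _ _ e2r) c25 isT.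
have c36 : comp x3 x6 by apply: comp_odd (cC _ _ e34) (c _ _ e45) (c _ _ e56).
set t := [:: p; q; x4; x5; s; r; x2].
have UY : uniq (x3 :: x6 :: x1 :: t).
  rewrite (@perm_uniq _ _ [:: s, r, q, p & X]); last by perm_by_count.
  by rewrite cons_uniq sX cons_uniq rX cons_uniq qX cons_uniq pX Ux.
move: UY; rewrite 2!cons_uniq [x3 \in _ :: _]inE negb_or => /and3P[/andP[n36 n3] n6 Ut].
have path_t : path e x1 t by rewrite /= e1p epq (eC _ _ e4q) e45 e5s (eC _ _ ers) (eC _ _ e2r).
have [P [eP lP UP memP]] :=
  hamilton_path_avoiding Ut (sub_path sub_comp path_t) erefl n36 n3 n6 c36.
have Uall : uniq ((x1 :: t) ++ x3 :: P).
  rewrite cat_uniq Ut UP andbT; by apply/hasPn=> z; rewrite memP in_setC in_set.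
have mem_all z : z \in (x1 :: t) ++ x3 :: P.
  by rewrite mem_cat memP in_setC in_set orbN.
pose H := x1 :: t ++ x3 :: P.
pose H' := x1 :: [:: p; q; x4] ++ (x3 :: P) ++ [:: x5; s; r; x2].
have perm : perm_eq H' H by perm_by_count.
have sumH : chain_sum phi (rcons H x1) = 0.
  apply: (@phi_hamilton x1 (t ++ x3 :: P)) => //.
  by rewrite rcons_cat cat_path path_t /= e23 rcons_path eP lP e61.
have sumH' : chain_sum phi (rcons H' x1) = 0.
  apply: (@phi_hamilton x1 ([:: p; q; x4] ++ (x3 :: P) ++ [:: x5; s; r; x2])).
    by rewrite (perm_uniq perm).
    rewrite rcons_path /= e1p epq (eC _ _ e4q) (eC _ _ e34) cat_path eP lP /=.
    by rewrite (eC _ _ e56) e5s (eC _ _ ers) (eC _ _ e2r) last_cat /= eC.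
  by move=> z; rewrite (perm_mem perm) mem_all.
pose S := chain_sum phi (x3 :: P).
have E : chain_sum phi (rcons H x1) = phi x1 p + (phi p q + (phi q x4 + (phi x4 x5 +
    (phi x5 s + (phi s r + (phi r x2 + (phi x2 x3 + (S + phi x6 x1)))))))).
  transitivity (phi x1 p + (phi p q + (phi q x4 + (phi x4 x5 + (phi x5 s + (phi s r +
    (phi r x2 + (phi x2 x3 + chain_sum phi ((x3 :: P) ++ [:: x1]))))))))); first by rewrite cats1.
  by rewrite chain_sum_cat_cons lP /= !addr0.
have E' : chain_sum phi (rcons H' x1) = phi x1 p + (phi p q + (phi q x4 + (phi x4 x3 +
    (S + phi x6 x5 + (phi x5 s + (phi s r + (phi r x2 + phi x2 x1))))))).
  transitivity (phi x1 p + (phi p q + (phi q x4 + (phi x4 x3 +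
    chain_sum phi ((x3 :: P) ++ [:: x5; s; r; x2; x1]))))).
    by rewrite /H' /= rcons_cat.
  by rewrite chain_sum_cat_cons lP /= !addr0.
rewrite (phi_sym x4 x3) (phi_sym x6 x5) (phi_sym x2 x1) in E'.
set C := (X in X = 0).
(* [D] gathers the edges common to both circuits; they cancel, and the six sides of the hexagon
   remain. *)
pose D := phi x1 p + phi p q + phi q x4 + phi x5 s + phi s r + phi r x2 + S.
have -> : C = chain_sum phi (rcons H x1) + chain_sum phi (rcons H' x1) - (D + D).
  by rewrite E E' /C /D; ring.
by rewrite sumH sumH' (V2 D) subr0 addr0.
Qed.

(** The hexagons [x1 x2 x3 y z w] and [x1 x4 x3 y z w] share the path [x3 y z w x1], and their sum
    is the 4-circuit. *)
Lemma phi_square x1 x2 x3 x4 : x1 != x3 -> x2 != x4 ->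
  e x1 x2 -> e x2 x3 -> e x3 x4 -> e x4 x1 ->
  phi x1 x2 + phi x2 x3 + phi x3 x4 + phi x4 x1 = 0.
Proof.
move=> n13 n24 e12 e23 e34 e41.
have eC x y : e x y -> e y x by rewrite e_sym.
have c x y : e x y -> comp x y := @sub_comp x y.
have cC x y : e x y -> comp y x by move=> exy; rewrite comp_sym c.
have ne x y : e x y -> x != y by move=> exy; apply: contraTneq exy => ->; rewrite e_irr.
set X := [:: x1; x2; x3; x4].
have UX : uniq X.
  by rewrite /= !inE !negb_or n13 n24 (ne _ _ e12) (ne _ _ e23) (ne _ _ e34) eq_sym (ne _ _ e41).
have [y e3y yX] := neighbour x3 (s := X) isT.
have [w e1w wX] := neighbour x1 (s := y :: X) isT.
have c3w : comp x3 w by apply: comp_odd (c _ _ e23) (cC _ _ e12) (c _ _ e1w).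
have [z [eyz ewz zX]] := common_neighbour (s := w :: y :: X) (cC _ _ e3y) c3w isT.
have UY : uniq [:: z, w, y & X] by rewrite cons_uniq zX cons_uniq wX cons_uniq yX.
have hexagon v : v \in [:: x2; x4] -> e x1 v -> e v x3 ->
    phi x1 v + phi v x3 + phi x3 y + phi y z + phi z w + phi w x1 = 0.
  move=> vX e1v ev3; apply: phi_hexagon => //; try exact: eC.
  apply: subseq_uniq (_ : uniq [:: x1; x2; x4; x3; y; z; w]).
    pose Z := [:: x1; x2; x4; x3; y; z; w]; pose m3 := nseq 4 true.
    move: vX; rewrite !inE => /orP[] /eqP->.
      exact: (mask_subseq [:: true, true, false & m3] Z).
    exact: (mask_subseq [:: true, false, true & m3] Z).
  by rewrite (@perm_uniq _ _ [:: z, w, y & X]) //; perm_by_count.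
have := hexagon x2; rewrite inE eqxx => /(_ isT e12 e23) E2.
have := hexagon x4; rewrite !inE eqxx orbT => /(_ isT (eC _ _ e41) (eC _ _ e34)) E4.
rewrite (phi_sym x3 x4) (phi_sym x4 x1).
set C := (X in X = 0); pose D := phi x3 y + phi y z + phi z w + phi w x1.
have -> : C = 0 + 0 - (D + D) by rewrite -{1}E2 -E4 /C /D; ring.
by rewrite (V2 D) subr0 addr0.
Qed.

Lemma phi_closed_walk4 x1 x2 x3 x4 : e x1 x2 -> e x2 x3 -> e x3 x4 -> e x4 x1 ->
  phi x1 x2 + phi x2 x3 + phi x3 x4 + phi x4 x1 = 0.
Proof.
move=> e12 e23 e34 e41.
have [<-|n13] := eqVneq x1 x3; first by rewrite (phi_sym x2) (phi_sym x4) V2 add0r V2.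
have [<-|n24] := eqVneq x2 x4; last exact: phi_square.
by rewrite (phi_sym x3 x2) (phi_sym x2 x1) -[X in X + _]addrA V2 addr0 V2.
Qed.

(** If two of [x1], [x3], [x5] coincide, a backtracking pair cancels and a closed 4-walk remains.
    Otherwise [x2], [x4], [x6] are replaced by new common neighbours that make a genuine hexagon, at
    the cost of three closed 4-walks. *)
Lemma phi_closed_walk6 x1 x2 x3 x4 x5 x6 :
  e x1 x2 -> e x2 x3 -> e x3 x4 -> e x4 x5 -> e x5 x6 -> e x6 x1 ->
  phi x1 x2 + phi x2 x3 + phi x3 x4 + phi x4 x5 + phi x5 x6 + phi x6 x1 = 0.
Proof.
move=> e12 e23 e34 e45 e56 e61.
have eC x y : e x y -> e y x by rewrite e_sym.
have c x y : e x y -> comp x y := @sub_comp x y.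
have [E|n13] := eqVneq x1 x3.
  rewrite -{}E in e23 e34 *; rewrite (phi_sym x2) V2 add0r.
  exact: phi_closed_walk4.
have [E|n35] := eqVneq x3 x5.
  rewrite -{}E in e45 e56 *; have := phi_closed_walk4 e12 e23 e56 e61 => W.
  by rewrite -(addrA _ (phi x3 x4)) (phi_sym x4) V2 addr0.
have [E|n15] := eqVneq x1 x5.
  rewrite -{}E in e45 e56 *; have := phi_closed_walk4 e12 e23 e34 e45 => W.
  by rewrite -(addrA _ (phi x1 x6)) (phi_sym x6) V2 addr0.
set X := [:: x1; x3; x5].
have [y2 [e1y y3e y2X]] := common_neighbour (s := X) (c _ _ e12) (c _ _ e23) isT.
have [y4 [e3y y5e y4X]] := common_neighbour (s := y2 :: X) (c _ _ e34) (c _ _ e45) isT.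
have [y6 [e5y y1e y6X]] := common_neighbour (s := y4 :: y2 :: X) (c _ _ e56) (c _ _ e61) isT.
have UX : uniq X by rewrite /= !inE !negb_or n13 n15 n35.
have UY : uniq [:: y6, y4, y2 & X] by rewrite cons_uniq y6X cons_uniq y4X cons_uniq y2X.
have E : phi x1 y2 + phi y2 x3 + phi x3 y4 + phi y4 x5 + phi x5 y6 + phi y6 x1 = 0.
  apply: phi_hexagon => //; try exact: eC.
  by rewrite (@perm_uniq _ _ [:: y6, y4, y2 & X]) //; perm_by_count.
have W1 := phi_closed_walk4 e12 e23 y3e (eC _ _ e1y).
have W3 := phi_closed_walk4 e34 e45 y5e (eC _ _ e3y).
have W5 := phi_closed_walk4 e56 e61 y1e (eC _ _ e5y).
rewrite (phi_sym x3 y2) (phi_sym y2 x1) in W1.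
rewrite (phi_sym x5 y4) (phi_sym y4 x3) in W3.
rewrite (phi_sym x1 y6) (phi_sym y6 x5) in W5.
set C := (X in X = 0).
pose D := phi x1 y2 + phi y2 x3 + phi x3 y4 + phi y4 x5 + phi x5 y6 + phi y6 x1.
have -> : C = 0 + 0 + 0 + 0 - (D + D).
  by rewrite -{1}W1 -{1}W3 -{1}W5 -{1}E /C /D; ring.
by rewrite (V2 D) subr0 !addr0.
Qed.

(** [A] is one side of the bipartition, or all vertices. The second potential reaches [y] through a
    chosen neighbour [n y] in [A]; the closed walk [r], [w v], [v], [y], [n y], [w (n y)] shows that
    any other neighbour [v] gives the same value. *)
Lemma phi_potential (A : {pred T}) r : r \in A ->
  {in A &, forall u v, exists2 z, comp u z & comp z v} ->
  exists q q' : T -> V, forall v y, v \in A -> e v y -> phi v y = q v + q' y.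
Proof.
move=> rA sameA.
(* The default [r] is never taken for [v] in [A], where a common neighbour with [r] exists. *)
pose w v := odflt r [pick w | e r w && e v w].
have wP v : v \in A -> e r (w v) /\ e (w v) v.
  move=> vA; rewrite /w; case: pickP => [w' /andP[-> evw]|/= no]; first by rewrite e_sym.
  have [z crz czv] := sameA _ _ rA vA.
  have [w' [erw evw _]] := common_neighbour (s := [::]) crz czv isT.
  by have := no w'; rewrite erw evw.
pose q v := phi r (w v) + phi (w v) v.
pose n y := odflt r [pick v | (v \in A) && e v y].
exists q, (fun y => phi (n y) y + q (n y)) => v y vA evy.
have [nA eny] : n y \in A /\ e (n y) y.
  by rewrite /n; case: pickP => [v' /andP[]//|/= /(_ v)]; rewrite vA evy.
have [erw ewv] := wP v vA; have [erw' ewv'] := wP _ nA.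
have eC x z : e x z -> e z x by rewrite e_sym.
have W := phi_closed_walk6 erw ewv evy (eC _ _ eny) (eC _ _ ewv') (eC _ _ erw').
rewrite (phi_sym (w (n y)) r) (phi_sym (n y) (w (n y))) (phi_sym y) in W.
apply/eqP; rewrite -subr_eq0; apply/eqP.
pose D := q v + phi (n y) y + q (n y).
have -> : phi v y - (q v + (phi (n y) y + q (n y))) = 0 - (D + D).
  by rewrite -W /D /q; ring.
by rewrite (V2 D) subr0.
Qed.

End DensePotential.

(** * Initial arrangements in complete and complete bipartite graphs *)

Section Arrangements.
Variable T : finType.
Implicit Types (A U : {set T}) (a b : seq T).

Lemma arrangement_any U u v : u != v -> u \in U -> v \in U ->
  exists p, [/\ uniq (u :: p), u :: p =i U, path (fun _ _ => true) u p
    & last u p = v].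
Proof.
move=> uv uU vU; exists (rcons (enum (U :\ u :\ v)) v); split.
- rewrite /= rcons_uniq enum_uniq andbT mem_rcons inE !mem_enum !inE !eqxx /=.
  by rewrite andbF orbF uv.
- move=> z; rewrite inE mem_rcons inE mem_enum !inE.
  have [->|_] := eqVneq z u; first by rewrite uU.
  by have [->|_] := eqVneq z v; rewrite ?vU.
- by apply/(pathP u).
- by rewrite last_rcons.
Qed.

Definition sides A : rel T := fun x y => (x \in A) != (y \in A).

Fixpoint interleave a b :=
  if (a, b) is (x :: a', y :: b') then x :: y :: interleave a' b' else [::].

Lemma perm_interleave a b : size a = size b -> perm_eq (interleave a b) (a ++ b).
Proof.
elim: a b => [|x a IHa] [|y b] //= [/IHa /permP p_ab]; apply/permP=> P /=.
by rewrite p_ab !count_cat /=; lia.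
Qed.

Lemma path_interleave A z a b : z \notin A ->
  {subset a <= A} -> {subset b <= ~: A} -> path (sides A) z (interleave a b).
Proof.
elim: a b z => [|x a IHa] [|y b] //= z zA sa sb.
have xA : x \in A by rewrite sa ?inE ?eqxx.
have yA : y \notin A by have := sb y; rewrite !inE eqxx; apply.
rewrite /sides xA (negbTE zA) (negbTE yA) IHa // => w w_in; first by rewrite sa ?inE ?w_in ?orbT.
by apply: sb; rewrite inE w_in orbT.
Qed.

Lemma last_interleave z a b y : size a = (size b).+1 ->
  last z (interleave a (rcons b y)) = y.
Proof.
elim: a b z => [|x a IHa] [|y' b] z //= [sz]; last exact: IHa.
by case: a sz {IHa}.
Qed.

(** The two sides are listed with [u] first on its own side and [v] last on the other, and the lists
    are then interleaved. *)
Lemma arrangement_balanced A U u v : u \in A -> v \notin A -> u \in U -> v \in U ->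
  #|U :&: A| = #|U :\: A| ->
  exists p, [/\ uniq (u :: p), u :: p =i U, path (sides A) u p & last u p = v].
Proof.
move=> uA vA uU vU eqUA.
pose a := enum ((U :&: A) :\ u); pose b := rcons (enum ((U :\: A) :\ v)) v.
have size_ab : size (u :: a) = size b.
  rewrite size_rcons /= -!cardE; move: eqUA.
  by rewrite (cardsD1 u (U :&: A)) (cardsD1 v (U :\: A)) !inE uU vU uA vA => /addnI->.
have [y [b' Eb]] : exists y b', b = y :: b' by case: b size_ab => // y b' _; exists y, b'.
have pm := perm_interleave size_ab.
have Ep : interleave (u :: a) b = u :: behead (interleave (u :: a) b) by rewrite Eb.
exists (behead (interleave (u :: a) b)); rewrite -Ep; split.
- rewrite (perm_uniq pm) cat_uniq /= !rcons_uniq !enum_uniq !mem_enum !inE !eqxx /= !andbT.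
  apply/hasPn=> z; rewrite mem_rcons !inE !mem_enum !inE.
  case/predU1P => [->|]; first by rewrite (negbTE vA) !andbF orbF; apply: contraNneq vA => ->.
  by case/and3P=> _ /negbTE zA _; rewrite zA !andbF orbF; apply: contraFneq zA => ->.
- move=> z; rewrite (perm_mem pm) mem_cat !inE mem_rcons !inE !mem_enum !inE.
  have [->|_] := eqVneq z u; first by rewrite uU.
  by have [->|_] := eqVneq z v; rewrite ?vU ?orbT //=; case: (z \in A); case: (z \in U).
- have sa : {subset u :: a <= A}.
    by move=> z; rewrite !inE mem_enum !inE => /predU1P[->//|/and3P[]].
  have sb : {subset b <= ~: A}.
    by move=> z; rewrite mem_rcons !inE mem_enum !inE => /predU1P[->//|/and3P[]].
  have := @path_interleave A v _ _ vA sa sb; rewrite Ep /= => /andP[_].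
  by rewrite Eb.
- by rewrite -[LHS]/(last u (u :: _)) -Ep last_interleave // size_ab size_rcons.
Qed.

Lemma sides_balanced A (t0 : T) t : path (sides A) t0 t -> odd (size t) ->
  count [in A] (t0 :: t) = count [predC A] (t0 :: t).
Proof.
have [n le_n] := ubnP (size t); elim: n t0 t le_n => // n IHn t0 [|t1 [|t2 t]] //= le_n.
  by rewrite /sides /= => /andP[]; case: (t0 \in A); case: (t1 \in A).
case/and3P=> s01 s12 pt; rewrite negbK => ot.
have lt_t : (size t < n)%N by clear -le_n; lia.
have /= -> := IHn t2 t lt_t pt ot.
by move: s01; rewrite /sides; case: (t0 \in A); case: (t1 \in A) => // _; lia.
Qed.

(** An alternating path with an odd number of steps meets both sides equally often, so its
    complement is still balanced. *)
Lemma arrangement_avoiding A (t0 : T) t u v : #|A| = #|~: A| ->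
  uniq (t0 :: t) -> path (sides A) t0 t -> odd (size t) ->
  u \notin t0 :: t -> v \notin t0 :: t -> sides A u v ->
  exists p, [/\ uniq (u :: p), u :: p =i ~: [set z in t0 :: t], path (sides A) u p
    & last u p = v].
Proof.
move=> eqA Ut pt ot ut vt suv; set S := [set z in t0 :: t]; set U := ~: S.
have cS (P : {set T}) : #|P :&: S| = count [in P] (t0 :: t).
  rewrite -size_filter -(card_uniqP (filter_uniq _ Ut)).
  by apply: eq_card => z; rewrite !inE mem_filter inE.
have eqU : #|U :&: A| = #|U :\: A|.
  have := cardsID S A; have := cardsID S (~: A); rewrite !cS.
  have -> : A :\: S = U :&: A by apply/setP=> z; rewrite !inE.
  have -> : ~: A :\: S = U :\: A by apply/setP=> z; rewrite !inE andbC.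
  have := sides_balanced pt ot.
  rewrite (@eq_count _ [in ~: A] [predC A]); last by move=> z; rewrite !inE.
  by lia.
have uU : u \in U by rewrite !inE.
have vU : v \in U by rewrite !inE.
move: suv; rewrite /sides; case uA: (u \in A); case vA: (v \in A) => // _.
  by apply: arrangement_balanced; rewrite ?vA.
(* When [u] lies outside [A], the two sides exchange roles. *)
have [] := @arrangement_balanced (~: A) U u v; rewrite ?inE ?uA ?vA //.
  by rewrite -setDE -eqU; congr #|pred_of_set _|; apply/setP=> z; rewrite !inE negbK andbC.
move=> p [Up mU pp lp]; exists p; split=> //.
by move: pp; apply: sub_path => x y; rewrite /sides !inE; case: (x \in A); case: (y \in A).
Qed.

End Arrangements.

(** * The cycle space *)

Lemma addF2 (a : 'F_2) : a + a = 0.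
Proof. by apply/val_inj; case: a => [[|[|a]] lt_a]. Qed.

Lemma natrF2_even n : ~~ odd n -> n%:R = 0 :> 'F_2.
Proof. by move=> /even_halfK <-; rewrite -addnn natrD addF2. Qed.

Lemma natrF2_odd n : odd n -> n%:R = 1 :> 'F_2.
Proof.
move=> on; rewrite -(odd_double_half n) on natrD.
by rewrite (@natrF2_even n./2.*2) ?odd_double ?addr0.
Qed.

(** The duality principle. For [v] outside [U] the vector [v - projv U v] is nonzero, and one of its
    coordinates, composed with [1 - projv U], kills [U] but not [v]. *)
Lemma subv_functional (K : fieldType) (vT : vectType K) (U V : {vspace vT}) :
  (forall g : 'Hom(vT, K^o), {in U, forall u, g u = 0} -> {in V, forall v, g v = 0}) ->
  (V <= U)%VS.
Proof.
move=> UV; apply/subvP=> v vV; apply: contraT => vU.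
pose w := v - projv U v.
have w0 : w != 0 by rewrite subr_eq0; apply: contraNneq vU => ->; apply: memv_proj.
pose b := vbasis (fullv : {vspace vT}).
have [i ci] : exists i, coord b i w != 0.
  apply/existsP; apply: contraNT w0 => /existsPn c0.
  rewrite (coord_vbasis (memvf w)) big1 // => i _.
  by have /negPn/eqP := c0 i; rewrite /b => ->; rewrite scale0r.
pose g : 'Hom(vT, K^o) := (linfun (coord b i : vT -> K^o) \o (\1 - projv U))%VF.
have gE x : g x = coord b i (x - projv U x).
  by rewrite comp_lfunE add_lfunE opp_lfunE id_lfunE lfunE.
have /UV/(_ v vV)/eqP : {in U, forall u, g u = 0}.
  by move=> u uU; rewrite gE projv_id // subrr linear0.
by rewrite gE (negbTE ci).
Qed.

(** * Circuits as cyclic lists of vertices *)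

Section CircuitOfSeq.
Variable X : sgraph.
Implicit Types (s : seq X) (x y z v w : X).

Definition circuit_of s : {set {set X}} := [set [set z; next s z] | z in s].

Lemma next_next_neq s z : uniq s -> (2 < size s)%N -> z \in s -> next s (next s z) != z.
Proof.
move=> Us szs zs; have [i [|a [|b t]] Es] := rot_to zs.
- by move: szs; rewrite -(size_rot i) Es.
- by move: szs; rewrite -(size_rot i) Es.
rewrite -!(next_rot i Us) Es; move: Us; rewrite -(rot_uniq i) Es /= => /andP[].
rewrite !inE !negb_or => /and3P[za zb _] _.
by rewrite eqxx [a == z]eq_sym (negbTE za) eqxx eq_sym.
Qed.

(** Two vertices with the same outgoing edge would be each other's successor, which forces a cycle
    of length at most 2. *)
Lemma circuit_edge_inj s : uniq s -> (2 < size s)%N ->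
  {in s &, injective (fun z => [set z; next s z])}.
Proof.
move=> Us szs z w zs ws E.
have ninj := can_inj (prev_next Us).
have : z \in [set w; next s w] by rewrite -E set21.
rewrite !inE => /orP[/eqP//|/eqP zw].
have : next s z \in [set w; next s w] by rewrite -E set22.
rewrite !inE => /orP[/eqP nz|/eqP/ninj//].
by have := next_next_neq Us szs ws; rewrite -zw nz eqxx.
Qed.

Lemma is_circuit_of s : uniq s -> (2 < size s)%N -> cycle (@adj X) s ->
  is_circuit [set z in s] (circuit_of s).
Proof.
move=> Us szs cs.
have nn z : z \in s -> next s z != z.
  move=> zs; apply: contraNneq (next_next_neq Us szs zs) => nz.
  by rewrite nz nz.
apply/and5P; split.
- case: s szs {Us cs nn} => // z s _; apply/set0Pn; exists z.
  by rewrite inE mem_head.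
- apply/subsetP=> f /imsetP[z zs ->]; apply/imsetP; exists (z, next s z) => //=.
  by rewrite inE; apply: next_cycle.
- apply/forall_inP=> f /imsetP[z zs ->]; apply/subsetP=> w.
  by rewrite !inE => /orP[/eqP->//|/eqP->]; rewrite mem_next.
- apply/forall_inP=> v; rewrite inE => vs.
  have ps : prev s v \in s by rewrite mem_prev.
  have pv : v != prev s v.
    by apply: contraTneq (nn _ ps) => Ev; rewrite next_prev // -Ev eqxx.
  (* The edges at [v] are the one leaving [v] and the one leaving its predecessor. *)
  have -> : [set f in circuit_of s | v \in f] =
      [set [set z; next s z] | z in [set v; prev s v]].
    apply/setP=> f; rewrite inE; apply/andP/imsetP => [[/imsetP[z zs ->]]|[z]].
      rewrite !inE => /orP[/eqP->|/eqP->]; exists z; rewrite // !inE ?eqxx //.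
      by rewrite prev_next // eqxx orbT.
    rewrite !inE => /orP[/eqP->|/eqP->] ->; split; rewrite ?inE ?eqxx //.
    + exact: imset_f.
    + exact: imset_f.
    + by rewrite next_prev // eqxx orbT.
  rewrite card_in_imset ?cards2 ?pv // => z w; rewrite !inE => zP wP.
  apply: circuit_edge_inj => //.
    by case/orP: zP => /eqP->.
  by case/orP: wP => /eqP->.
- apply/forall_inP=> x; rewrite inE => xs; apply/forall_inP=> y; rewrite inE => ys.
  apply: (connect_cycle _ xs ys).
  apply: (@sub_in_cycle _ [in s] (frel (next s))) (cycle_next Us).
    by move=> z w zs ws /= /eqP<-; apply: imset_f.
  exact/allP.
Qed.

Lemma chain_sum_cycle (V : nmodType) (f : X -> X -> V) x p : uniq (x :: p) ->
  chain_sum f (x :: rcons p x) = \sum_(z <- x :: p) f z (next (x :: p) z).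
Proof.
(* [next] is generalised to any function followed by the steps of the closed list, so that induction
   on the list goes through. *)
move=> /cycle_next; set n := next _; rewrite /cycle -(belast_rcons x p x).
clearbody n; move: (rcons p x) => t; elim: t x => [|y t IHt] z.
  by rewrite big_nil /= addr0.
case/andP=> /eqP Ez /IHt {}IHt; rewrite [LHS]/= -[X in _ + X]/(chain_sum f (y :: t)).
by rewrite IHt /= big_cons Ez.
Qed.

End CircuitOfSeq.

(** * Linear functionals on chains as edge weights *)

Section Functionals.
Variable X : sgraph.
Local Notation C1 := {ffun edge X -> ('F_2)^o}.
Implicit Types (F : {set {set X}}) (g : 'Hom(C1, ('F_2)^o)).

Lemma edgeP (f : {set X}) : reflect (exists x y, adj x y /\ f = [set x; y]) (f \in edges X).
Proof.
apply: (iffP imsetP) => [[[x y]]|[x [y [xy ->]]]]; last by exists (x, y); rewrite ?inE.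
by rewrite inE /= => xy ->; exists x, y.
Qed.

Lemma sum_edges (V : nmodType) (h : {set X} -> V) (P : pred {set X}) :
  (forall f, P f -> f \in edges X) ->
  \sum_(f : edge X | P (val f)) h (val f) = \sum_(f | P f) h f.
Proof.
move=> PE; rewrite [RHS](reindex_omap (val : edge X -> {set X}) insub) => [|f /PE fE].
  by apply: eq_bigl => f; rewrite valK eqxx andbT.
by rewrite insubT.
Qed.

Definition pairing (h : {set X} -> 'F_2) (z : C1) : ('F_2)^o :=
  \sum_f z f * h (val f).

Fact pairing_is_linear h : linear (pairing h).
Proof.
move=> a c d; rewrite /pairing scaler_sumr -big_split /=.
by apply: eq_bigr => f _; rewrite !ffunE mulrDl [in RHS]/GRing.scale /= mulrA.
Qed.

HB.instance Definition _ h :=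
  GRing.isLinear.Build 'F_2 C1 ('F_2)^o _ (pairing h) (pairing_is_linear h).

Lemma pairing_chain h F : F \subset edges X ->
  pairing h (edge_chain F) = \sum_(f in F) h f.
Proof.
move=> /subsetP FE; rewrite -sum_edges // [RHS]big_mkcond /=.
apply: eq_bigr => f _; rewrite ffunE.
by case: (val f \in F); rewrite ?mul1r ?mul0r.
Qed.

Definition chain_total : C1 -> ('F_2)^o := pairing (fun=> 1).

Lemma chain_total_chain F : F \subset edges X -> chain_total (edge_chain F) = #|F|%:R.
Proof. by move=> FE; rewrite /chain_total pairing_chain // sumr_const. Qed.

(** These are the coordinates of [g] on single edges, extended by 0 to all vertex sets so that no
    membership proof has to be carried along. *)
Definition weight g (f : {set X}) : 'F_2 :=
  if insub f is Some f' then g [ffun f'' : edge X => (f'' == f')%:R] else 0.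

Lemma functionalE g (z : C1) : g z = pairing (weight g) z.
Proof.
have {1}-> : z = \sum_f z f *: [ffun f'' : edge X => (f'' == f)%:R].
  apply/ffunP=> f; rewrite sum_ffunE (bigD1 f) //= big1 ?addr0.
    by rewrite !ffunE eqxx /GRing.scale /= mulr1.
  by move=> f' ne; rewrite !ffunE eq_sym (negbTE ne) scaler0.
rewrite linear_sum; apply: eq_bigr => f _.
by rewrite linearZ /weight valK.
Qed.

Lemma boundary_chain F v : F \subset edges X ->
  boundary (edge_chain F) v = #|[set f in F | v \in f]|%:R.
Proof.
move=> /subsetP FE; rewrite ffunE -sum1_card natr_sum.
rewrite -(@sum_edges _ (fun=> 1) (fun f => f \in [set f in F | v \in f])); last first.
  by move=> f; rewrite inE => /andP[/FE].
rewrite [LHS]big_mkcond [RHS]big_mkcond /=.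
by apply: eq_bigr => f _; rewrite ffunE inE andbC; case: (v \in _); case: (_ \in F).
Qed.

Lemma Z1E (z : C1) : z \in Z1 X -> boundary z = 0.
Proof. by rewrite memv_ker lfunE => /eqP. Qed.

Lemma circuit_Z1 W F : is_circuit W F -> edge_chain F \in Z1 X.
Proof.
case/and5P=> _ FE /forall_inP FW /forall_inP deg2 _.
rewrite memv_ker lfunE /=; apply/eqP/ffunP=> v; rewrite boundary_chain // ffunE.
have [/deg2/eqP->|vW] := boolP (v \in W); first exact: natrF2_even.
rewrite (_ : [set f in F | v \in f] = set0) ?cards0 //.
apply/setP=> f; rewrite !inE; apply/negbTE; rewrite negb_and -implybE.
by apply/implyP=> /FW/subsetP fW; apply: contra vW; apply: fW.
Qed.

Lemma card_edge f : f \in edges X -> #|f| = 2%N.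
Proof.
case/edgeP=> x [y [xy ->]]; rewrite cards2.
by have [Exy|] := eqVneq x y; first by rewrite Exy adj_irrefl in xy.
Qed.

(** Double counting of incidences: every edge has two ends and every vertex of [W] has degree 2. *)
Lemma card_circuit W F : is_circuit W F -> #|F| = #|W|.
Proof.
case/and5P=> _ /subsetP FE /forall_inP FW /forall_inP deg2 _.
suff : (#|F| * 2 = #|W| * 2)%N by move/eqP; rewrite eqn_pmul2r // => /eqP.
rewrite -!sum_nat_const.
transitivity (\sum_(f in F) \sum_(v in W | v \in f) 1)%N.
  apply: eq_bigr => f fF; rewrite -(card_edge (FE _ fF)) -sum1_card.
  by apply: eq_bigl => v; rewrite andbC; case vf: (v \in f) => //=; rewrite (subsetP (FW _ fF)).
rewrite (exchange_big_dep [in W]) /=; last by move=> f v _ /andP[].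
apply: eq_bigr => v vW.
have /eqP <- : #|[set f in F | v \in f]| == 2%N := deg2 _ vW.
rewrite -sum1_card.
by apply: eq_bigl => f; rewrite inE vW.
Qed.

Lemma circuit_span_sub (S : {set {set {set X}}}) (V : {vspace C1}) :
  (circuit_span S <= V)%VS <-> {in S, forall F, edge_chain F \in V}.
Proof.
split=> [/span_subvP sub F FS|sub].
  by apply: sub; apply/imageP; exists F.
by apply/span_subvP=> c /imageP[F FS ->]; apply: sub.
Qed.

Lemma chain_in_span (S : {set {set {set X}}}) F : F \in S -> edge_chain F \in circuit_span S.
Proof. by move=> FS; have /circuit_span_sub := subvv (circuit_span S); apply. Qed.

Lemma hamilton_span_sub_Z1 : (circuit_span (hamilton_circuits X) <= Z1 X)%VS.
Proof. by apply/circuit_span_sub=> F; rewrite inE => /circuit_Z1. Qed.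

Lemma long_span_sub_Z1 : (circuit_span (long_circuits X) <= Z1 X)%VS.
Proof.
by apply/circuit_span_sub=> F; rewrite !inE => /andP[/existsP[W /circuit_Z1]].
Qed.

(** The part [q x + q y] is a coboundary: exchanging the sums over edges and their ends pairs [q]
    with the boundary of [z], which is 0. *)
Lemma functional_potential g (q : X -> 'F_2) c :
  (forall x y, adj x y -> weight g [set x; y] = q x + q y + c) ->
  {in Z1 X, forall z, g z = c * chain_total z}.
Proof.
move=> gq z /Z1E bz; rewrite functionalE /chain_total /pairing mulr_sumr.
apply/eqP; rewrite -subr_eq0 -sumrB; apply/eqP.
transitivity (\sum_(f : edge X) \sum_(v | v \in val f) q v * z f).
  apply: eq_bigr => f _; have /edgeP[x [y [xy Ef]]] := valP f.
  rewrite Ef gq // -mulr_suml.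
  have nxy : x != y by apply: contraTneq xy => ->; rewrite adj_irrefl.
  rewrite (eq_bigl (mem [set x; y])) // big_setU1 ?inE //= big_set1.
  by rewrite mulr1 [X in _ - X]mulrC -mulrBr addrK mulrC.
rewrite (exchange_big_dep xpredT) //= big1 // => v _.
rewrite -mulr_sumr; have /ffunP/(_ v) := bz; rewrite !ffunE => ->.
exact: mulr0.
Qed.

End Functionals.

(** * Dense graphs *)

Section DenseGraphs.
Variable X : sgraph.
Local Notation C1 := {ffun edge X -> ('F_2)^o}.
Implicit Types (g : 'Hom(C1, ('F_2)^o)).

Lemma mindeg_le (v : X) : (mindeg X <= deg v)%N.
Proof.
rewrite /mindeg; have : v \in index_enum X by rewrite mem_index_enum.
elim: (index_enum X) => //= x r IHr; rewrite inE big_cons geq_min.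
by case/predU1P=> [->|/IHr->]; rewrite ?leqnn ?orbT.
Qed.

Lemma mindeg_ge k : (k <= f0 X)%N -> (forall v : X, (k <= deg v)%N) -> (k <= mindeg X)%N.
Proof.
move=> kf kd; rewrite /mindeg.
by elim/big_ind: _ => // a b ka kb; rewrite leq_min ka.
Qed.

Lemma weight_hamilton g : {in hamilton_circuits X, forall F, g (edge_chain F) = 0} ->
  (2 < f0 X)%N -> forall x p, uniq (x :: p) -> path (@adj X) x (rcons p x) ->
  (forall z, z \in x :: p) ->
  chain_sum (fun x y => weight g [set x; y]) (x :: rcons p x) = 0.
Proof.
move=> g0 n2 x p Up pp mp; set s := x :: p in Up mp.
have szs : (2 < size s)%N.
  suff -> : size s = f0 X by [].
  by rewrite -(card_uniqP Up); apply: eq_card => z; rewrite mp.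
have := is_circuit_of Up szs pp.
have -> : [set z in s] = setT by apply/setP=> z; rewrite in_setT in_set mp.
move=> cs; have /and5P[_ sE _ _ _] := cs.
have := g0 (circuit_of s); rewrite inE => /(_ cs).
rewrite functionalE pairing_chain // big_imset; last exact: circuit_edge_inj.
by rewrite (chain_sum_cycle _ Up) (big_uniq _ Up).
Qed.

Section NonBipartite.
Hypothesis n_gt0 : (0 < f0 X)%N.
Hypothesis hdeg : forall v : X, (f0 X + 20 <= 2 * deg v)%N.

Let n_ge20 : (20 <= f0 X)%N.
Proof.
have /card_gt0P[v _] := n_gt0; have := hdeg v.
by have : (deg v <= f0 X)%N := max_card _; lia.
Qed.

Let compT : rel X := fun _ _ => true.

(** With all vertices on one side, symmetry of [phi] makes [q + q'] agree at the two ends of every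
    edge. Since any vertex has a common neighbour with [r], this sum is a constant [c], and [q'] can
    be replaced by [q + c]. *)
Lemma dense_functional g : {in hamilton_circuits X, forall F, g (edge_chain F) = 0} ->
  exists c, {in Z1 X, forall z, g z = c * chain_total z}.
Proof.
move=> g0; pose phi x y := weight g [set x; y].
have /card_gt0P[r _] := n_gt0.
have phiC x y : phi x y = phi y x by rewrite /phi setUC.
have n2 : (2 < f0 X)%N by apply: leq_trans n_ge20.
have side x : (#|[set w | compT x w]| <= f0 X)%N by apply: max_card.
have arr t0 t u v : uniq (t0 :: t) -> path compT t0 t -> odd (size t) ->
    u != v -> u \notin t0 :: t -> v \notin t0 :: t -> compT u v ->
    exists p, [/\ uniq (u :: p), u :: p =i ~: [set z in t0 :: t], path compT u p
      & last u p = v].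
  by move=> _ _ _ uv ut vt _; apply: arrangement_any; rewrite // in_setC in_set.
have [] := @phi_potential X (@adj X) compT (f0 X) (@adj_sym X) (@adj_irrefl X)
  (fun _ _ => erefl) (fun _ _ _ => isT) (fun _ _ _ _ _ _ _ => isT) side hdeg arr
  'F_2 phi addF2 phiC (weight_hamilton g0 n2) predT r isT.
  by move=> u v _ _; exists u.
move=> q [q' qq'].
have qE u y : adj u y -> q u + q' u = q y + q' y.
  move=> uy; have yu : adj y u by rewrite adj_sym.
  have := phiC u y; rewrite !qq' // => E.
  apply/eqP; rewrite -subr_eq0; apply/eqP.
  have -> : q u + q' u - (q y + q' y) =
    (q u + q' y) - (q y + q' u) + (q' u + q' u) - (q' y + q' y) by ring.
  by rewrite E subrr !addF2 subr0.
exists (q r + q' r); apply: (@functional_potential X g q) => x y xy.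
have [w [rw yw _]] := @common_neighbour X (@adj X) compT (f0 X)
  (fun _ _ => erefl) (fun _ _ _ => isT) (fun _ _ _ _ _ _ _ => isT) side hdeg
  r y r [::] isT isT isT.
rewrite (qE _ _ rw) -(qE _ _ yw) -[LHS]/(phi x y) qq' //.
by rewrite -addrA (addrA (q y)) addF2 add0r.
Qed.

(** A Hamilton path of the complement of [S] with adjacent ends closes up. The empty [S] gives a
    Hamilton circuit, a singleton a circuit of length [f0 X - 1]. *)
Lemma dense_circuit (S : {set X}) : (#|S| <= 1)%N -> exists F, is_circuit (~: S) F.
Proof.
move=> S1; set U := ~: S.
have nS : (#|S| + #|U| = f0 X)%N by rewrite /U cardsC.
have dS (z : X) : (deg z <= #|[set w in U | adj z w]| + 1)%N.
  rewrite /deg -(cardsID S) addnC leq_add //.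
    by apply/subset_leq_card/subsetP=> w; rewrite !inE => /andP[-> ->].
  by apply: leq_trans S1; rewrite subset_leq_card // subsetIr.
have /card_gt0P[x xU] : (0 < #|U|)%N by have := n_ge20; lia.
have /card_gt0P[y] : (0 < #|[set w in U | adj x w]|)%N.
  by have := dS x; have := hdeg x; lia.
rewrite inE => /andP[yU xy].
have nxy : x != y by apply: contraTneq xy => ->; rewrite adj_irrefl.
have [p0 [Up0 m0 c0 l0]] := arrangement_any nxy xU yU.
have [] := @hamilton_path_between X (@adj X) compT (@adj_sym X) (@adj_irrefl X)
   (fun _ _ => erefl) (fun _ _ _ => isT) (fun _ _ _ _ _ _ _ => isT) U _ x y p0 Up0 m0 c0 l0.
  move=> u v _ _ _; have : (#|[set w in U | compT v w]| <= f0 X)%N by apply: max_card.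
  by have := dS u; have := dS v; have := hdeg u; have := hdeg v; lia.
move=> p [pp lp Up mp]; exists (circuit_of (x :: p)).
have <- : [set z in x :: p] = U by apply/setP=> z; rewrite in_set mp.
apply: is_circuit_of => //.
  by rewrite -(card_uniqP Up) (eq_card mp); have := n_ge20; lia.
by rewrite /= rcons_path pp lp adj_sym.
Qed.

Lemma dense_hamilton : exists2 F, F \in hamilton_circuits X & #|F| = f0 X.
Proof.
have [|F cF] := @dense_circuit set0; first by rewrite cards0.
exists F; first by rewrite inE -setC0.
by rewrite (card_circuit cF) setC0 cardsT.
Qed.

Lemma dense_hamilton_generated : odd (f0 X) -> hamilton_generated X.
Proof.
move=> on; apply/eqP; rewrite eqEsubv hamilton_span_sub_Z1 /=.
apply: subv_functional => g g0.
have {}g0 : {in hamilton_circuits X, forall F, g (edge_chain F) = 0}.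
  by move=> F FS; apply/g0/chain_in_span.
have [c gc] := dense_functional g0.
have [F FH cF] := dense_hamilton.
have cFH : is_circuit [set: X] F by move: FH; rewrite inE.
have /and5P[_ FE _ _ _] := cFH.
move=> z zZ; rewrite gc //.
(* On a Hamilton circuit, whose length is odd, [g] takes the value [c]; hence [c = 0]. *)
have := gc _ (circuit_Z1 cFH); rewrite g0 // chain_total_chain // cF natrF2_odd // mulr1 => <-.
exact: mul0r.
Qed.

Lemma dense_long_generated : ~~ odd (f0 X) ->
  circuit_span (long_circuits X) = Z1 X.
Proof.
move=> en; apply/eqP; rewrite eqEsubv long_span_sub_Z1 /=.
apply: subv_functional => g g0.
have {}g0 : {in long_circuits X, forall F, g (edge_chain F) = 0}.
  by move=> F FS; apply/g0/chain_in_span.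
have [|c gc] := @dense_functional g.
  move=> F; rewrite inE => cF; apply: g0; rewrite !inE (card_circuit cF) cardsT.
  by rewrite eqxx orbT andbT; apply/existsP; exists setT.
have /card_gt0P[r _] := n_gt0.
have [|F cF] := @dense_circuit [set r]; first by rewrite cards1.
have cardF : #|F| = (f0 X).-1 by rewrite (card_circuit cF) cardsC1.
have FL : F \in long_circuits X.
  by rewrite !inE cardF eqxx andbT; apply/existsP; exists (~: [set r]).
have /and5P[_ FE _ _ _] := cF.
move=> z zZ; rewrite gc //.
have := gc _ (circuit_Z1 cF); rewrite g0 // chain_total_chain // cardF natrF2_odd.
  by rewrite mulr1 => <-; rewrite mul0r.
by move: en; rewrite -{1}(prednK n_gt0) /= negbK.
Qed.

(** The span is exactly the set of cycles with an even number of edges. This has codimension one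
    because a circuit missing a single vertex has odd length. *)
Lemma dense_codim1 : ~~ odd (f0 X) -> hamilton_codim1 X.
Proof.
move=> en; split; first exact: hamilton_span_sub_Z1.
pose eps : 'Hom(C1, ('F_2)^o) := linfun (pairing (fun=> 1)).
have -> : circuit_span (hamilton_circuits X) = (Z1 X :&: lker eps)%VS.
  apply/eqP; rewrite eqEsubv subv_cap hamilton_span_sub_Z1 /=; apply/andP; split.
    apply/circuit_span_sub=> F; rewrite inE => cF; have /and5P[_ FE _ _ _] := cF.
    rewrite memv_ker lfunE [X in X == _]chain_total_chain // (card_circuit cF) cardsT.
    by rewrite natrF2_even.
  apply: subv_functional => g g0 z /memv_capP[zZ].
  rewrite memv_ker lfunE => /eqP /= z0.
  have [|c gc] := @dense_functional g.
    by move=> F FS; apply/g0/chain_in_span.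
  by rewrite gc // /chain_total z0 mulr0.
suff d1 : \dim (eps @: Z1 X) = 1%N by rewrite -(limg_ker_dim eps (Z1 X)) d1 addn1.
have /card_gt0P[r _] := n_gt0.
have [|F cF] := @dense_circuit [set r]; first by rewrite cards1.
have cardF : #|F| = (f0 X).-1 by rewrite (card_circuit cF) cardsC1.
have /and5P[_ FE _ _ _] := cF.
have epsF : eps (edge_chain F) = 1.
  rewrite lfunE [LHS]chain_total_chain // cardF natrF2_odd //.
  by move: en; rewrite -{1}(prednK n_gt0) /= negbK.
apply/eqP; rewrite eqn_leq; apply/andP; split.
  by apply: leq_trans (dimvS (subvf _)) _; rewrite dimvf.
rewrite lt0n dimv_eq0; apply/eqP=> im0.
have : eps (edge_chain F) \in (eps @: Z1 X)%VS by apply/memv_img/(circuit_Z1 cF).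
by rewrite im0 memv0 epsF oner_eq0.
Qed.

End NonBipartite.

Lemma dense_bipartite_generated (A : {set X}) : (0 < f0 X)%N ->
  #|A| = #|~: A| -> (forall x y : X, adj x y -> (x \in A) != (y \in A)) ->
  (forall v : X, (#|A| + 20 <= 2 * deg v)%N) -> hamilton_generated X.
Proof.
move=> n0 cA bipA hdeg.
apply/eqP; rewrite eqEsubv hamilton_span_sub_Z1 /=; apply: subv_functional => g g0.
have {}g0 : {in hamilton_circuits X, forall F, g (edge_chain F) = 0}.
  by move=> F FS; apply/g0/chain_in_span.
have nA : (f0 X = #|A| + #|A|)%N by rewrite {2}cA cardsC.
have /card_gt0P[r rA] : (0 < #|A|)%N by lia.
have side x : (#|[set w | sides A x w]| <= #|A|)%N.
  have [xA|xA] := boolP (x \in A); last first.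
    apply: subset_leq_card; apply/subsetP=> w; rewrite inE /sides (negbTE xA).
    by case: (w \in A).
  rewrite cA; apply: subset_leq_card; apply/subsetP=> w; rewrite !inE /sides xA.
  by case: (w \in A).
have n2 : (2 < f0 X)%N.
  have : (deg r <= f0 X)%N := max_card _.
  by have := hdeg r; lia.
have sC : symmetric (sides A) by move=> x y; rewrite /sides eq_sym.
have sO x y z w : sides A x y -> sides A x z -> sides A z w -> sides A y w.
  by rewrite /sides; do 4!case: (_ \in A).
pose phi x y := weight g [set x; y].
have phiC x y : phi x y = phi y x by rewrite /phi setUC.
have arr t0 t u v : uniq (t0 :: t) -> path (sides A) t0 t -> odd (size t) ->
    u != v -> u \notin t0 :: t -> v \notin t0 :: t -> sides A u v ->
    exists p, [/\ uniq (u :: p), u :: p =i ~: [set z in t0 :: t], path (sides A) u p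
      & last u p = v].
  by move=> Ut pt ot _; apply: arrangement_avoiding.
have /card_gt0P[r' r'A] : (0 < #|~: A|)%N by lia.
have [] := @phi_potential X (@adj X) (sides A) #|A| (@adj_sym X) (@adj_irrefl X)
  sC bipA sO side hdeg arr 'F_2 phi addF2 phiC (weight_hamilton g0 n2) [in A] r rA.
  by move: r'A; rewrite inE => r'A u v uA vA; exists r'; rewrite /sides ?uA ?vA (negbTE r'A).
move=> q [q' qq'].
(* Every edge has one end on each side, so the two potentials glue to a single one with [c = 0]. *)
pose Q x := if x \in A then q x else q' x.
move=> z zZ; rewrite (@functional_potential X g Q 0) ?mul0r // => x y xy.
rewrite addr0 /Q -[LHS]/(phi x y); have := bipA _ _ xy.
case xA: (x \in A); case yA: (y \in A) => // _; first by rewrite qq'.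
by rewrite phiC addrC qq' // adj_sym.
Qed.

End DenseGraphs.

(** * Counterexamples *)

Section CircuitDegrees.
Variable X : sgraph.
Implicit Types (F T : {set {set X}}) (W : {set X}).

Lemma edge_adj (x y : X) : ([set x; y] \in edges X) = adj x y.
Proof.
apply/edgeP/idP => [[x' [y' [x'y' E]]]|]; last by exists x, y.
have n' : x' != y' by apply: contraTneq x'y' => ->; rewrite adj_irrefl.
have := set21 x y; rewrite E !inE => /orP[] /eqP Ex; rewrite Ex in E *.
  have := set22 x' y'; rewrite -E !inE => /orP[/eqP Ey|/eqP<- //].
  by rewrite Ey eqxx in n'.
have := set21 x' y'; rewrite -E !inE => /orP[/eqP Ey|/eqP<- //].
  by rewrite Ey eqxx in n'.
by rewrite adj_sym.
Qed.

(** This puts the degree condition into a form that case analysis on the few possible edges at [v]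
    can settle. *)
Lemma circuit_degree W F (v : X) (s : seq X) : is_circuit W F -> v \in W -> uniq s ->
  (forall w, adj v w -> w \in s) -> count (fun w => [set v; w] \in F) s = 2%N.
Proof.
case/and5P=> _ /subsetP FE _ /forall_inP deg2 _ vW Us sv.
have /eqP <- : #|[set f in F | v \in f]| == 2%N := deg2 _ vW.
rewrite -size_filter -(card_uniqP (filter_uniq _ Us)).
have nv w : [set v; w] \in F -> adj v w by move/FE; rewrite edge_adj.
have -> : [set f in F | v \in f] =
    [set [set v; w] | w in [seq w <- s | [set v; w] \in F]].
  apply/setP=> f; rewrite inE; apply/andP/imsetP => [[fF vf]|[w]].
    have /edgeP[x [y [xy Ef]]] := FE _ fF.
    move: vf; rewrite Ef !inE => /orP[]/eqP Ev; [exists y|exists x]; rewrite ?mem_filter.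
    - by rewrite Ev -Ef fF sv // Ev.
    - by rewrite Ev.
    - by rewrite Ev setUC -Ef fF sv // Ev adj_sym.
    - by rewrite Ev setUC.
  by rewrite mem_filter => /andP[wF _] ->; rewrite wF set21.
rewrite card_in_imset // => w w'; rewrite !mem_filter => /andP[/nv vw _] /andP[/nv vw' _] E.
have := set22 v w; rewrite E !inE => /orP[/eqP Ew|/eqP//].
by rewrite Ew adj_irrefl in vw.
Qed.

(** The functional with weights [h] kills the span of the Hamilton circuits, so it separates the
    circuit [T] from that span. *)
Lemma not_hamilton_generated (h : {set X} -> 'F_2) W T :
  {in hamilton_circuits X, forall F, \sum_(f in F) h f = 0} ->
  is_circuit W T -> \sum_(f in T) h f != 0 -> ~ hamilton_generated X.
Proof.
move=> h0 cT hT HG; have TZ := circuit_Z1 cT.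
have /and5P[_ TE _ _ _] := cT.
pose g : 'Hom({ffun edge X -> ('F_2)^o}, ('F_2)^o) := linfun (pairing h).
have sub : (circuit_span (hamilton_circuits X) <= lker g)%VS.
  apply/circuit_span_sub=> F FH; rewrite memv_ker lfunE /= pairing_chain ?h0 //.
  by move: FH; rewrite inE => /and5P[].
rewrite HG in sub; have := subvP sub _ TZ.
by rewrite memv_ker lfunE /= pairing_chain // (negbTE hT).
Qed.

Lemma sum_indicator F (a : {set X}) : \sum_(f in F) (f == a)%:R = (a \in F)%:R :> 'F_2.
Proof.
have [aF|aF] := boolP (a \in F).
  by rewrite (bigD1 a) //= eqxx big1 ?addr0 // => f /andP[_ /negbTE->].
by rewrite big1 // => f fF; case: eqP => // Ef; rewrite -Ef fF in aF.
Qed.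

(* A Hamilton circuit cannot contain all three sides of the triangle [a b c], so
   it runs through the triangle along a path. *)
Lemma cubic_triangle F (a b c a' b' c' : X) : F \in hamilton_circuits X ->
  a' \notin [:: a; b; c] -> uniq [:: a; b; c] ->
  uniq [:: b; c; a'] -> uniq [:: a; c; b'] -> uniq [:: a; b; c'] ->
  (forall w, adj a w -> w \in [:: b; c; a']) ->
  (forall w, adj b w -> w \in [:: a; c; b']) ->
  (forall w, adj c w -> w \in [:: a; b; c']) ->
  ([set a; a'] \in F) = ([set b; c] \in F).
Proof.
rewrite inE => cF a'n Uabc Ua Ub Uc Na Nb Nc.
have := circuit_degree cF (in_setT a) Ua Na.
have := circuit_degree cF (in_setT b) Ub Nb.
have := circuit_degree cF (in_setT c) Uc Nc.
have /and5P[_ /subsetP FE _ _ /forall_inP conn] := cF.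
pose e u w := [set u; w] \in F.
have eC : symmetric e by move=> u w; rewrite /e setUC.
have eadj u w : e u w -> adj u w by move/FE; rewrite edge_adj.
have no_tri : ~~ [&& e a b, e a c, e b c, ~~ e a a', ~~ e b b' & ~~ e c c'].
  apply/negP=> /and5P[ab ac bc aa' /andP[bb' cc']].
  (* With no circuit edge leaving it, the triangle would be a union of components of the circuit,
     although [a'] is reachable from [a]. *)
  have cl : closed e [in [:: a; b; c]].
    apply: (intro_closed (sym_connect_sym eC)) => u w uw.
    rewrite !inE => /or3P[]/eqP Eu; rewrite Eu in uw.
    - have := Na _ (eadj _ _ uw); rewrite !inE => /or3P[]/eqP Ew; rewrite Ew ?eqxx ?orbT //.
      by rewrite Ew (negbTE aa') in uw.
    - have := Nb _ (eadj _ _ uw); rewrite !inE => /or3P[]/eqP Ew; rewrite Ew ?eqxx ?orbT //.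
      by rewrite Ew (negbTE bb') in uw.
    - have := Nc _ (eadj _ _ uw); rewrite !inE => /or3P[]/eqP Ew; rewrite Ew ?eqxx ?orbT //.
      by rewrite Ew (negbTE cc') in uw.
  have /forall_inP/(_ a' (in_setT _)) ca' := conn a (in_setT _).
  have := closed_connect cl ca'; rewrite (negbTE a'n).
  by rewrite inE eqxx.
move: no_tri; rewrite /= -/(e a b) -/(e a c) -/(e b c) -/(e a a') -/(e b b') -/(e c c').
rewrite -/(e b a) -/(e c a) -/(e c b) !(eC c) (eC b a) !addn0.
move=> nt /eqP Ec /eqP Eb /eqP Ea; move: nt Ec Eb Ea.
by case: (e a b); case: (e a c); case: (e b c); case: (e a a'); case: (e b b'); case: (e c' c).
Qed.

End CircuitDegrees.

(** * Small graphs given by edge lists *)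

Section ListGraphs.
Variables (n : nat) (E : seq (nat * nat)).
Hypothesis loopless : all (fun p => p.1 != p.2) E.

Definition list_rel : rel nat := fun i j => ((i, j) \in E) || ((j, i) \in E).

Fact list_adj_sym : symmetric (relpre (val : 'I_n -> nat) list_rel).
Proof. by move=> i j; rewrite /= /list_rel orbC. Qed.

Fact list_adj_irrefl : irreflexive (relpre (val : 'I_n -> nat) list_rel).
Proof.
move=> i; apply/negbTE; rewrite /= /list_rel orbb.
by apply/negP=> /(allP loopless); rewrite /= eqxx.
Qed.

Definition list_graph : sgraph := SGraph list_adj_sym list_adj_irrefl.

Lemma card_ord_count (P : pred nat) : #|[set i : 'I_n | P i]| = count P (iota 0 n).
Proof. by rewrite -val_enum_ord count_map cardsE cardE -size_filter enumT. Qed.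

Lemma list_graph_mindeg k : (k <= n)%N ->
  all (fun v => k <= count (list_rel v) (iota 0 n))%N (iota 0 n) -> (k <= mindeg list_graph)%N.
Proof.
move=> kn /allP kd; apply: mindeg_ge => [|v]; first by rewrite /f0 card_ord.
have -> : deg v = count (list_rel (val (v : 'I_n))) (iota 0 n) := card_ord_count _.
apply: kd.
by rewrite mem_iota ltn_ord.
Qed.

(** The hypothesis is a search through all orders of the remaining vertices; it is phrased on
    natural numbers so that it can be evaluated. *)
Lemma list_graph_hamilton_connected :
  all (fun x => all (fun y => (x == y) ||
         has (fun p => path list_rel x p && (last x p == y))
             (permutations (rem x (iota 0 n))))
       (iota 0 n)) (iota 0 n) ->
  hamilton_connected list_graph.
Proof.
move=> /allP all_paths x y nxy.
have lt_iota (z : 'I_n) : (z : nat) \in iota 0 n by rewrite mem_iota ltn_ord.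
have /allP/(_ _ (lt_iota y)) := all_paths _ (lt_iota x).
rewrite val_eqE (negbTE nxy) /= => /hasP[p]; rewrite mem_permutations => pm /andP[pp /eqP lp].
have permp : perm_eq (val x :: p) (iota 0 n).
  by rewrite perm_sym (permPl (perm_to_rem (lt_iota x))) perm_cons perm_sym.
pose p' : seq list_graph := pmap insub p.
have Ep : map val p' = p.
  rewrite (pmap_filter (insubK _)); apply/all_filterP/allP=> k kp.
  have : k \in iota 0 n by rewrite -(perm_mem permp) inE kp orbT.
  by rewrite mem_iota isSome_insub.
exists p'; split.
- by move: pp; rewrite -Ep path_map.
- by apply: ord_inj; rewrite -lp -Ep last_map.
- by rewrite -(map_inj_uniq val_inj) map_cons Ep (perm_uniq permp) iota_uniq.
- by move=> z; rewrite -(mem_map val_inj) map_cons Ep (perm_mem permp) lt_iota.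
Qed.

End ListGraphs.

(** The triangle 0, 2, 6 of vertices of degree 3 is joined to 1, 5, 4 respectively; the vertices 1,
    3, 4, 5 span a complete graph without the edge between 1 and 5. *)
Definition cubic_triangle_edges : seq (nat * nat) :=
  [:: (0, 1); (0, 2); (0, 6); (1, 3); (1, 4); (2, 5); (2, 6); (3, 4); (3, 5);
      (4, 5); (4, 6)]%N.

Lemma hamilton_connected_not_generated : exists X : sgraph,
  [/\ odd (f0 X), ((f0 X)./2 <= mindeg X)%N, hamilton_connected X
    & ~ hamilton_generated X].
Proof.
exists (@list_graph 7 cubic_triangle_edges isT); set X := list_graph _ _.
have f07 : f0 X = 7%N by rewrite /f0 card_ord.
split; rewrite ?f07 //.
- by apply: list_graph_mindeg.
- by apply: list_graph_hamilton_connected; vm_compute.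
pose v0 : X := @Ordinal 7 0 isT; pose v1 : X := @Ordinal 7 1 isT.
pose v2 : X := @Ordinal 7 2 isT; pose v4 : X := @Ordinal 7 4 isT.
pose v5 : X := @Ordinal 7 5 isT; pose v6 : X := @Ordinal 7 6 isT.
(* By [cubic_triangle] a Hamilton circuit uses both of these edges or neither, whereas the triangle
   uses only the second. *)
pose h (f : {set X}) : 'F_2 := (f == [set v0; v1])%:R + (f == [set v2; v6])%:R.
have sumE (F : {set {set X}}) :
    \sum_(f in F) h f = ([set v0; v1] \in F)%:R + ([set v2; v6] \in F)%:R.
  by rewrite big_split; congr (_ + _); apply: (@sum_indicator X).
have cT : is_circuit [set z in [:: v0; v2; v6]] (circuit_of [:: v0; v2; v6]).
  exact: is_circuit_of.
apply: (not_hamilton_generated _ cT (h := h)).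
  move=> F FH; rewrite sumE (@cubic_triangle X F v0 v2 v6 v1 v5 v4) ?addF2 //.
  - by case=> [[|[|[|[|[|[|[|w]]]]]]] lt_w].
  - by case=> [[|[|[|[|[|[|[|w]]]]]]] lt_w].
  - by case=> [[|[|[|[|[|[|[|w]]]]]]] lt_w].
rewrite sumE.
have -> : [set v2; v6] \in circuit_of [:: v0; v2; v6].
  by apply/imsetP; exists v2.
have /negbTE-> : [set v0; v1] \notin circuit_of [:: v0; v2; v6].
  apply/imsetP=> -[z zs E]; have := set22 v0 v1; rewrite E.
  by move: zs; rewrite !inE => /or3P[]/eqP->.
by rewrite add0r oner_eq0.
Qed.

Definition chorded_hexagon_edges : seq (nat * nat) :=
  [:: (0, 1); (1, 2); (2, 3); (3, 4); (4, 5); (5, 0); (0, 3)]%N.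

Lemma hamiltonian_not_generated (R : realType) : exists X : sgraph,
  [/\ square_bipartite X, (1 / 4 : R) * (f0 X)%:R <= (mindeg X)%:R,
      hamiltonian X & ~ hamilton_generated X].
Proof.
exists (@list_graph 6 chorded_hexagon_edges isT); set X := list_graph _ _.
have f06 : f0 X = 6%N by rewrite /f0 card_ord.
pose v0 : X := @Ordinal 6 0 isT; pose v1 : X := @Ordinal 6 1 isT.
pose v2 : X := @Ordinal 6 2 isT; pose v3 : X := @Ordinal 6 3 isT.
pose v4 : X := @Ordinal 6 4 isT; pose v5 : X := @Ordinal 6 5 isT.
split.
- exists [set i : X | odd (i : 'I_6)]; split.
    rewrite (_ : ~: _ = [set i : X | ~~ odd (i : 'I_6)]); last by apply/setP=> i; rewrite !inE.
    by rewrite (card_ord_count 6 odd) (card_ord_count 6 (fun i => ~~ odd i)).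
  have bip : all (fun p => odd p.1 != odd p.2) chorded_hexagon_edges by [].
  move=> x y; rewrite !inE /= /list_rel => /orP[] /(allP bip) //=.
  by rewrite eq_sym.
- have : (2 <= mindeg X)%N by apply: list_graph_mindeg.
  by rewrite f06 -(ler_nat R) => le2; lra.
- pose s := [:: v0; v1; v2; v3; v4; v5].
  exists (circuit_of s); rewrite inE.
  have -> : [set: X] = [set z in s].
    by apply/setP; case=> [[|[|[|[|[|[|w]]]]]] lt_w]; rewrite !inE.
  exact: is_circuit_of.
have cT : is_circuit [set z in [:: v0; v1; v2; v3]] (circuit_of [:: v0; v1; v2; v3]).
  exact: is_circuit_of.
(* Vertices 1 and 5 have degree 2, so a Hamilton circuit uses both edges from 0 to them and not the
   chord; the 4-circuit 0, 1, 2, 3 does use the chord. *)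
apply: (not_hamilton_generated _ cT (h := fun f => (f == [set v0; v3])%:R)).
  move=> F; rewrite inE sum_indicator => cF.
  have N1 w : adj v1 w -> w \in [:: v0; v2].
    by case: w => [[|[|[|[|[|[|w]]]]]] lt_w].
  have N5 w : adj v5 w -> w \in [:: v0; v4].
    by case: w => [[|[|[|[|[|[|w]]]]]] lt_w].
  have N0 w : adj v0 w -> w \in [:: v1; v5; v3].
    by case: w => [[|[|[|[|[|[|w]]]]]] lt_w].
  have /eqP := circuit_degree (s := [:: v0; v2]) cF (in_setT v1) isT N1.
  have /eqP := circuit_degree (s := [:: v0; v4]) cF (in_setT v5) isT N5.
  have /eqP := circuit_degree (s := [:: v1; v5; v3]) cF (in_setT v0) isT N0.
  rewrite /= (setUC [set v5] [set v0]) (setUC [set v1] [set v0]).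
  case: ([set v0; v3] \in F); case: ([set v0; v1] \in F) => //.
    by case: ([set v0; v5] \in F) => // _; case: (_ \in F).
  by move=> _ _; case: (_ \in F).
rewrite sum_indicator.
have -> : [set v0; v3] \in circuit_of [:: v0; v1; v2; v3].
  by apply/imsetP; exists v3; rewrite // setUC.
exact: oner_neq0.
Qed.

(** * From the degree thresholds to the additive surplus *)

Lemma dense_conclusion (X : sgraph) : (0 < f0 X)%N ->
  (forall v : X, (f0 X + 20 <= 2 * deg v)%N) ->
  (odd (f0 X) -> hamilton_generated X) /\
  (~~ odd (f0 X) -> hamilton_codim1 X /\ circuit_span (long_circuits X) = Z1 X).
Proof.
move=> n0 hdeg; split=> par; first exact: dense_hamilton_generated.
by split; [apply: dense_codim1 | apply: dense_long_generated].
Qed.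

Theorem theorem1p1 (R : realType) :
  (forall gamma : R, 0 < gamma ->
     exists n0 : int, forall X : sgraph, n0 <= (f0 X)%:Z ->
       [/\ (* I1 *)
           (1 / 2 + gamma) * (f0 X)%:R <= (mindeg X)%:R ->
             odd (f0 X) -> hamilton_generated X,
           (* I2 *)
           (1 / 2 + gamma) * (f0 X)%:R <= (mindeg X)%:R ->
             ~~ odd (f0 X) ->
             hamilton_codim1 X /\ circuit_span (long_circuits X) = Z1 X
         & (* I3 *)
           (1 / 4 + gamma) * (f0 X)%:R <= (mindeg X)%:R ->
             square_bipartite X -> hamilton_generated X])
  /\ (* I4 *)
  (forall X : sgraph, (2 * 10 ^ 8 <= f0 X)%N ->
     (2 / 3 : R) * (f0 X)%:R <= (mindeg X)%:R ->
     (odd (f0 X) -> hamilton_generated X) /\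
     (~~ odd (f0 X) ->
        hamilton_codim1 X /\ circuit_span (long_circuits X) = Z1 X))
  /\
  (exists X : sgraph,
     [/\ odd (f0 X), ((f0 X)./2 <= mindeg X)%N, hamilton_connected X
       & ~ hamilton_generated X])
  /\
  (exists X : sgraph,
     [/\ square_bipartite X, (1 / 4 : R) * (f0 X)%:R <= (mindeg X)%:R,
         hamiltonian X & ~ hamilton_generated X]).
Proof.
have deg_le (X : sgraph) (v : X) (a : R) : a <= (mindeg X)%:R -> a <= (deg v)%:R.
  by move=> le_a; apply: le_trans le_a _; rewrite ler_nat mindeg_le.
split; last split; last split.
(* Writing [n] for [f0 X], this choice gives [gamma * n >= 20]. Twice a degree then exceeds [n], or
   [n / 2 = #|A|] in the bipartite case, by at least [2 * gamma * n >= 40]. *)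
- move=> gamma g0; exists (Num.bound (20 / gamma))%:Z => X; rewrite lez_nat => le_n.
  have n_large : 20 <= gamma * (f0 X)%:R.
    rewrite -ler_pdivrMl // mulrC ltW //.
    apply: lt_le_trans (_ : (Num.bound (20 / gamma))%:R <= _); last by rewrite ler_nat.
    by rewrite archi_boundP // divr_ge0 // ltW.
  have n_gt0 : (0 < f0 X)%N.
    by rewrite lt0n; apply/eqP=> n0; move: n_large; rewrite n0 mulr0; lra.
  have hdeg (v : X) : (1 / 2 + gamma) * (f0 X)%:R <= (mindeg X)%:R ->
      (f0 X + 20 <= 2 * deg v)%N.
    move=> /(deg_le _ v); rewrite -(ler_nat R) natrD natrM; lra.
  split=> [d|d|d [A [cA bipA]]].
  + by case: (dense_conclusion n_gt0 (fun v => hdeg v d)).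
  + by case: (dense_conclusion n_gt0 (fun v => hdeg v d)).
  + have nA : (f0 X)%:R = #|A|%:R + #|A|%:R :> R.
      by rewrite -natrD {2}cA cardsC.
    apply: dense_bipartite_generated cA bipA _ => // v.
    move: d => /(deg_le _ v); rewrite -(ler_nat R) natrD natrM; lra.
- move=> X n_large d.
  (* Twice a degree is at least [4 n / 3], which reaches [n + 20] once [n >= 60]; the weaker bound
     keeps the numerals small. *)
  have {}n_large : (2 * 10 ^ 2 <= f0 X)%N.
    by apply: leq_trans n_large; rewrite leq_pmul2l // leq_pexp2l.
  apply: dense_conclusion => [|v]; first exact: leq_trans n_large.
  move: n_large d => + /(deg_le _ v).
  rewrite -(ler_nat R) -(ler_nat R (_ + _)) natrD natrM natrX natrM; lra.
- exact: hamilton_connected_not_generated.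
- exact: hamiltonian_not_generated.
Qed.
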